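(* Consider an $m\times n$ net in $\mathbb{R}^d$ such that the corners of each $2\times 1$ sub-net and of each $1\times 2$ sub-net are non-collinear (i.e. the four corners do not all lie on one line). Then the net satisfies the condition ''in each $1\times 2$ sub-net or in each $2\times 1$ sub-net, the two faces are affine symmetric with respect to their common edge'' (that is, either this holds for all $1\times 2$ sub-nets, or for all $2\times 1$ sub-nets) if and only if it is a doubled cone-cylinder net.
   Context: An $m\times n$ net is a collection of $(m+1)(n+1)$ points $P_{ij}\in\mathbb{R}^d$, $0\le i\le m$, $0\le j\le n$ (not necessarily distinct), such that for all $0\le i<m$, $0\le j<n$ the points $P_{ij},P_{i+1,j},P_{i+1,j+1},P_{i,j+1}$ are consecutive vertices of a convex (planar, non-degenerate) quadrilateral. These quadrilaterals are the faces and their sides are the edges; they are labeled by the indices of their vertices. The corners of an $m\times n$ net are the points $P_{00},P_{0n},P_{m0},P_{mn}$. An $a\times b$ sub-net of an $m\times n$ net $P_{ij}$ is the $a\times b$ net formed by the points $P_{ij}$ with $p\le i\le p+a$, $q\le j\le q+b$, for some integers $0\le p\le m-a$ and $0\le q\le n-b$. Two quadrilaterals in $\mathbb{R}^d$ with a common side are affine symmetric with respect to the common side if there is an affine map taking the first quadrilateral to the second one and keeping the points of the common side fixed (labels are ignored). A $1\times n$ net $P_{ij}$ ($0\le i\le 1$, $0\le j\le n$) is a cone strip if all the lines $P_{0j}P_{1j}$, $0\le j\le n$, are concurrent or all are parallel. A doubled cone-cylinder strip is a cone strip such that for each $0\le j\le n-2$ one has $P_{0,j}P_{0,j+2}\parallel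 P_{1,j}P_{1,j+2}$ and the points $P_{0,j},P_{0,j+2},P_{1,j},P_{1,j+2}$ are non-collinear. For $m\times 1$ nets the same notions are defined with the roles of the two indices interchanged. An $m\times n$ net is a doubled cone-cylinder net if each $1\times n$ sub-net or each $m\times 1$ sub-net is a doubled cone-cylinder strip. *)

(* Defs.v *)
From mathcomp Require Import all_boot all_order all_algebra.
From mathcomp Require Import boolp classical_sets reals.

Set Implicit Arguments.
Unset Strict Implicit.
Unset Printing Implicit Defensive.

Import Order.TTheory GRing.Theory Num.Theory.
Local Open Scope classical_set_scope.
Local Open Scope ring_scope.

Section Geometry.
Context {R : realType} {d : nat}.
Local Notation pt := 'rV[R]_d.
Implicit Types A B C D : pt.

(* The line AB; it is the point {A} when A = B. *)
Definition line A B : set pt := [set X | exists t : R, X = A + t *: (B - A)].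

Definition segment A B : set pt :=
  [set X | exists t : R, [/\ 0 <= t, t <= 1 & X = A + t *: (B - A)]].

(* For d > 0, allowing L = M changes nothing, as a point lies on some line. *)
Definition collinear (s : seq pt) : Prop :=
  exists L M : pt, forall X, X \in s -> line L M X.

(* AB and CD are genuine lines with the same direction; coinciding lines are
   parallel. *)
Definition parallel A B C D : Prop :=
  [/\ A != B, C != D & (B - A == D - C)%MS].

(* C and D lie strictly on the same side of the line AB, inside the plane ABC;
   in particular A, B, C, D are coplanar. *)
Definition same_side A B C D : Prop :=
  ~ collinear [:: A; B; C] /\
  exists x y : R, 0 < y /\ D - A = x *: (B - A) + y *: (C - A).

(* A, B, C, D are consecutive vertices of a planar convex quadrilateral without
   zero or straight angles: the line of each side leaves the other two vertices
   strictly on one side. *)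
Definition convex_quad A B C D : Prop :=
  [/\ same_side A B C D, same_side B C D A,
      same_side C D A B & same_side D A B C].

(* The convex quadrilateral as a plane region, i.e. the convex hull of its
   vertices: this forgets the labels of the vertices. *)
Definition quadrilateral A B C D : set pt :=
  [set X | exists a b c e : R,
    [/\ [/\ 0 <= a, 0 <= b, 0 <= c & 0 <= e], a + b + c + e = 1 &
        X = a *: A + b *: B + c *: C + e *: D]].

Definition affine_map (f : pt -> pt) : Prop :=
  exists (M : 'M[R]_d) (b : pt), forall X, f X = X *m M + b.

Definition affine_symmetric (Q1 Q2 side : set pt) : Prop :=
  exists f : pt -> pt,
    [/\ affine_map f, f @` Q1 = Q2 & forall X, side X -> f X = X].

(* An m x n net is given by the values P i j with i <= m and j <= n; the other
   values of P are never used. *)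
Implicit Type P : nat -> nat -> pt.

Definition net (m n : nat) P : Prop :=
  forall i j, (i < m)%N -> (j < n)%N ->
    convex_quad (P i j) (P i.+1 j) (P i.+1 j.+1) (P i j.+1).

Definition face P (i j : nat) : set pt :=
  quadrilateral (P i j) (P i.+1 j) (P i.+1 j.+1) (P i j.+1).

Definition corners (m n : nat) P : seq pt :=
  [:: P 0%N 0%N; P 0%N n; P m 0%N; P m n].

(* The interchange of the two indices. *)
Definition net_tr P : nat -> nat -> pt := fun i j => P j i.

Definition sub_net (p q : nat) P : nat -> nat -> pt :=
  fun i j => P (p + i)%N (q + j)%N.

(* Every a x b sub-net of the m x n net P has the property K. *)
Definition each_sub_net (a b m n : nat) P
    (K : (nat -> nat -> pt) -> Prop) : Prop :=
  forall p q, (p + a <= m)%N -> (q + b <= n)%N -> K (sub_net p q P).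

Definition concurrent_rulings (n : nat) P : Prop :=
  exists O : pt, forall j, (j <= n)%N -> line (P 0%N j) (P 1%N j) O.

Definition parallel_rulings (n : nat) P : Prop :=
  forall j k, (j <= n)%N -> (k <= n)%N ->
    parallel (P 0%N j) (P 1%N j) (P 0%N k) (P 1%N k).

(* These two predicates concern 1 x n nets; an m x 1 net is a strip when its
   image by net_tr is. *)
Definition cone_strip (n : nat) P : Prop :=
  concurrent_rulings n P \/ parallel_rulings n P.

Definition doubled_cone_cylinder_strip (n : nat) P : Prop :=
  cone_strip n P /\
  forall j, (j.+2 <= n)%N ->
    parallel (P 0%N j) (P 0%N j.+2) (P 1%N j) (P 1%N j.+2) /\
    ~ collinear [:: P 0%N j; P 0%N j.+2; P 1%N j; P 1%N j.+2].

Definition doubled_cone_cylinder_net (m n : nat) P : Prop :=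
  each_sub_net 1 n m n P (doubled_cone_cylinder_strip n) \/
  each_sub_net m 1 m n P (fun Q => doubled_cone_cylinder_strip m (net_tr Q)).

Definition affine_symmetric_1x2 P : Prop :=
  affine_symmetric (face P 0 0) (face P 0 1) (segment (P 0%N 1%N) (P 1%N 1%N)).

Definition affine_symmetric_2x1 P : Prop :=
  affine_symmetric (face P 0 0) (face P 1 0) (segment (P 1%N 0%N) (P 1%N 1%N)).

End Geometry.

(* Main.v *)
(* Let A_j, B_j be the points of a 1 x n net and let f be an affine map taking
   one face of a 1 x 2 sub-net to the other and fixing their common side A_1 B_1
   pointwise. Comparing the quadrilaterals in affine coordinates based on that
   side shows that f(A_0) = A_2 and f(B_0) = B_2. If the lines A_0 B_0 and
   A_1 B_1 meet in O, then f fixes O, so O lies on A_2 B_2; if they are parallel,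
   then so is A_2 B_2. By induction the whole strip is a cone strip; and
   A_0 A_2 || B_0 B_2 because B_0 has the same coordinates in the frame
   (A_1, B_1, A_0) as B_2 in (A_1, B_1, A_2). Conversely, in a doubled
   cone-cylinder strip A_0 A_2 || B_0 B_2 makes A_0, B_0 and A_2, B_2 divide their
   rulings alike relative to O (or to A_1 B_1), so the affine map sending
   A_1, B_1, A_0 to A_1, B_1, A_2 takes B_0 to B_2. *)

Require Import Defs.
From mathcomp Require Import all_boot all_order all_algebra.
From mathcomp Require Import boolp classical_sets reals.
From mathcomp Require Import ring lra.

Set Implicit Arguments.
Unset Strict Implicit.
Unset Printing Implicit Defensive.

Import Order.TTheory GRing.Theory Num.Theory.
Local Open Scope classical_set_scope.
Local Open Scope ring_scope.

Section PlaneGeometry.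
Context {R : realType} {d : nat}.
Local Notation pt := 'rV[R]_d.
Implicit Types (A B C D O U V W X : pt) (P Q : nat -> nat -> pt).

(** * Convex quadrilaterals in affine frames *)

Definition free_pair U V : Prop :=
  forall s t : R, s *: U + t *: V = 0 -> s = 0 /\ t = 0.

(** With three vertices at (0, 0), (1, 0), (0, 1), the fourth lies in the open first quadrant,
    strictly beyond the diagonal x + y = 1. *)
Definition convex_coords (x y : R) : Prop := [/\ 0 < x, 0 < y & 1 < x + y].

(* O is a vertex of the convex quadrilateral O U W V, and W is the opposite
   one. *)
Definition convex_frame O U V W : Prop :=
  free_pair (U - O) (V - O) /\
  exists x y : R,
    convex_coords x y /\ W - O = x *: (U - O) + y *: (V - O).

Lemma line_left A B : line A B A.
Proof. by exists 0; rewrite scale0r addr0. Qed.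

Lemma line_right A B : line A B B.
Proof. by exists 1; rewrite scale1r addrC subrK. Qed.

Lemma collinear_sub (s1 s2 : seq pt) :
  {subset s1 <= s2} -> collinear s2 -> collinear s1.
Proof. by move=> s12 [L [M h]]; exists L, M => X /s12 /h. Qed.

Lemma free_pair_eq U V s t s' t' :
  free_pair U V -> s *: U + t *: V = s' *: U + t' *: V -> s = s' /\ t = t'.
Proof.
move=> UV e; have [] := UV (s - s') (t - t').
  by apply/rowP=> i; move/rowP: e => /(_ i); rewrite !mxE => e; lra.
by move=> /subr0_eq-> /subr0_eq->.
Qed.

Lemma noncollinear_free A B C :
  ~ collinear [:: A; B; C] -> free_pair (B - A) (C - A).
Proof.
move=> ncol s t e; apply: contrapT => st; apply: ncol.
have [t0|t0] := eqVneq t 0.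
  have s0 : s != 0 by apply/eqP=> s0; apply: st.
  have BA : B = A.
    apply/subr0_eq/eqP; move: e; rewrite t0 scale0r addr0 => /eqP.
    by rewrite scaler_eq0 (negPf s0).
  exists A, C => X; rewrite !inE BA => /or3P[] /eqP ->.
  - exact: line_left.
  - exact: line_left.
  - exact: line_right.
exists A, B => X; rewrite !inE => /or3P[] /eqP ->.
- exact: line_left.
- exact: line_right.
- exists (- s / t); apply/rowP=> i; move/rowP: e => /(_ i); rewrite !mxE => e.
  have -> : C 0 i = A 0 i - s * (B 0 i - A 0 i) / t.
    by apply: (mulfI t0); rewrite mulrBr mulrCA divff// mulr1; lra.
  by field.
Qed.

(** Solving the relation for [C] replaces y by 1 / y, again positive. This serves to reverse the
    orientation of a quadrilateral. *)
Lemma same_side_flip A B C D : same_side A B C D -> same_side B A D C.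
Proof.
case=> ncol [x [y [y0 e]]].
have eC i : C 0 i = A 0 i + (D 0 i - A 0 i) / y - x / y * (B 0 i - A 0 i).
  move/rowP: e => /(_ i); rewrite !mxE => ->; field; exact: lt0r_neq0.
split.
  move=> [L [M h]]; apply: ncol; exists L, M.
  have [a ea] : line L M A by apply: h; rewrite !inE eqxx ?orbT.
  have [b eb] : line L M B by apply: h; rewrite !inE eqxx ?orbT.
  have [c ec] : line L M D by apply: h; rewrite !inE eqxx ?orbT.
  move=> X; rewrite !inE => /or3P[] /eqP ->; [by exists a|by exists b|].
  exists (a + (c - a) / y - x / y * (b - a)).
  by apply/rowP=> i; rewrite eC ea eb ec !mxE; field; exact: lt0r_neq0.
exists (1 + x / y - 1 / y), (1 / y); split; first by rewrite divr_gt0.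
by apply/rowP=> i; rewrite !mxE eC; field; exact: lt0r_neq0.
Qed.

Lemma convex_quad_rot A B C D : convex_quad A B C D -> convex_quad B C D A.
Proof. by case. Qed.

Lemma convex_quad_rev A B C D : convex_quad A B C D -> convex_quad A D C B.
Proof. by case=> *; split; exact: same_side_flip. Qed.

(** For [C] in the frame ([A], [D], [B]), the conditions at the sides [D A], [A B] and [B C] give y
    > 0, x > 0 and x + y > 1 respectively. *)
Lemma convex_quad_frame A B C D : convex_quad A B C D -> convex_frame A D B C.
Proof.
case=> [[_ [a [b [b0 e1]]]] [_ [x3 [y3 [y30 e3]]]] _ [ncol [x2 [y2 [y20 e2]]]]].
have fr : free_pair (D - A) (B - A).
  have h := noncollinear_free ncol; move=> s t e.
  have [] := h (- s - t) t; last by move=> p q; split; lra.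
  by rewrite -e; apply/rowP=> i; rewrite !mxE; ring.
have bN0 := lt0r_neq0 b0.
have eC : C - A = (1 - x2 - y2) *: (D - A) + y2 *: (B - A).
  by apply/rowP=> i; move/rowP: e2 => /(_ i); rewrite !mxE => e; lra.
have eC' : C - A = (1 / b) *: (D - A) + (- a / b) *: (B - A).
  by apply/rowP=> i; move/rowP: e1 => /(_ i); rewrite !mxE => ->; field.
split=> //; exists (1 - x2 - y2), y2; split=> //.
have [eb ea] : 1 - x2 - y2 = 1 / b /\ y2 = - a / b.
  by apply: (free_pair_eq fr); rewrite -eC.
have x0 : 0 < 1 - x2 - y2 by rewrite eb divr_gt0.
have : x3 * (1 - x2 - y2) + y3 = 0 /\ x3 * (y2 - 1) - y3 = -1.
  apply: (free_pair_eq fr); apply/rowP=> i.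
  move/rowP: e3 => /(_ i); move/rowP: eC => /(_ i); rewrite !mxE => eC e3.
  have -> : -1 * (B 0 i - A 0 i) = A 0 i - B 0 i by ring.
  by rewrite e3 -(subrK (A 0 i) (C 0 i)) eC; ring.
move: x0; set x := 1 - x2 - y2; move=> x0 [h1 h2]; split=> //.
(* Elimination of [x3] from [h1] and [h2]. *)
have h : y3 * (x + y2 - 1) = x by nra.
by have := pmulr_rgt0 (x + y2 - 1) y30; rewrite h x0; lra.
Qed.

(** * The quadrilateral as a region *)

Lemma quadrilateral_rot A B C D : quadrilateral A B C D = quadrilateral B C D A.
Proof.
apply/seteqP; split=> X [a [b [c [e [[? ? ? ?] s1 ->]]]]].
- exists b, c, e, a; split=> //; first lra.
  by apply/rowP=> i; rewrite !mxE; ring.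
- exists e, a, b, c; split=> //; first lra.
  by apply/rowP=> i; rewrite !mxE; ring.
Qed.

Lemma quadrilateral_rev A B C D : quadrilateral A B C D = quadrilateral D C B A.
Proof.
have sub E F G H : quadrilateral E F G H `<=` quadrilateral H G F E.
  move=> X [a [b [c [e [[? ? ? ?] s1 ->]]]]].
  exists e, c, b, a; split=> //; first lra.
  by apply/rowP=> i; rewrite !mxE; ring.
by apply/seteqP; split; exact: sub.
Qed.

Lemma vertices_quadrilateral A B C D :
  [/\ quadrilateral A B C D A, quadrilateral A B C D B,
      quadrilateral A B C D C & quadrilateral A B C D D].
Proof.
split; [exists 1, 0, 0, 0|exists 0, 1, 0, 0|exists 0, 0, 1, 0|exists 0, 0, 0, 1];
  (split; [by split|by rewrite ?(addr0, add0r)|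
  by rewrite !scale0r scale1r ?(addr0, add0r)]).
Qed.

(** * Affine maps *)

Lemma affine_mapB (M : 'M[R]_d) (b : pt) (f : pt -> pt) X Y :
  (forall Z, f Z = Z *m M + b) -> f X - f Y = (X - Y) *m M.
Proof. by move=> fE; rewrite !fE mulmxBl opprD addrACA subrr addr0. Qed.

Lemma affine_map_coords (f : pt -> pt) O U V (s t : R) : affine_map f ->
  f (O + s *: (U - O) + t *: (V - O)) =
  f O + s *: (f U - f O) + t *: (f V - f O).
Proof.
move=> [M [b fE]]; rewrite !(affine_mapB _ _ fE) !fE 2!mulmxDl -!scalemxAl.
by rewrite addrAC; congr (_ + _); rewrite addrAC.
Qed.

Lemma affine_map_line (f : pt -> pt) A B (t : R) : affine_map f ->
  f (A + t *: (B - A)) = f A + t *: (f B - f A).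
Proof. by move/(affine_map_coords A B B t 0); rewrite !scale0r !addr0. Qed.

Lemma affine_map_fix_line (f : pt -> pt) A B O :
  affine_map f -> f A = A -> f B = B -> line A B O -> f O = O.
Proof. by move=> aff fA fB [t ->]; rewrite affine_map_line// fA fB. Qed.

Lemma image_quadrilateral (f : pt -> pt) A B C D : affine_map f ->
  f @` quadrilateral A B C D = quadrilateral (f A) (f B) (f C) (f D).
Proof.
move=> [M [v fE]].
have key (a b c e : R) : a + b + c + e = 1 ->
    f (a *: A + b *: B + c *: C + e *: D) =
    a *: f A + b *: f B + c *: f C + e *: f D.
  move=> s1; rewrite !fE !mulmxDl -!scalemxAl -[in LHS](scale1r v) -s1.
  by apply/rowP=> i; rewrite !mxE; ring.
apply/seteqP; split=> X.
  move=> [Y [a [b [c [e [h s1 ->]]]]] <-].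
  by exists a, b, c, e; rewrite key.
move=> [a [b [c [e [h s1 ->]]]]].
exists (a *: A + b *: B + c *: C + e *: D); last exact: key.
by exists a, b, c, e.
Qed.

(** The frame need not span the space, so the linear part is built from a right inverse of the
    matrix with rows [U - O] and [V - O]. *)
Lemma affine_map_of_frame O U V V' : free_pair (U - O) (V - O) ->
  exists f, [/\ affine_map f, f O = O, f U = U & f V = V'].
Proof.
move=> fr; pose B := col_mx (U - O) (V - O); pose B' := col_mx (U - O) (V' - O).
have Bfree : row_free B.
  apply: inj_row_free => v; rewrite -[v]hsubmxK mul_row_col.
  rewrite [lsubmx v]mx11_scalar [rsubmx v]mx11_scalar !mul_scalar_mx => /fr[-> ->].
  by rewrite (raddf0 (@scalar_mx R 1)) row_mx0.
pose M := pinvmx B *m B'.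
have : B *m M = B' by rewrite mulmxA mulmxVp// mul1mx.
rewrite mul_col_mx => /eq_col_mx[UM VM].
exists (fun X => (X - O) *m M + O); split.
- by exists M, (O - O *m M) => X; rewrite mulmxBl addrAC addrA.
- by rewrite subrr mul0mx add0r.
- by rewrite UM subrK.
- by rewrite VM subrK.
Qed.

(** * Recovering the vertices from the region *)

(* The half-planes bounded by the sides of the quadrilateral with vertices
   (0, 0), (1, 0), (x, y), (0, 1). *)
Definition in_quad (x y s t : R) : Prop :=
  [/\ 0 <= s, 0 <= t, (s - 1) * y <= (x - 1) * t & (t - 1) * x <= (y - 1) * s].

Lemma quadrilateral_coords O U V W X (x y : R) :
  convex_coords x y -> W - O = x *: (U - O) + y *: (V - O) ->
  quadrilateral O U W V X ->
  exists s t, in_quad x y s t /\ X = O + s *: (U - O) + t *: (V - O).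
Proof.
move=> [x0 y0 xy1] eW [a [b [c [e [[a0 b0 c0 e0] s1 ->]]]]].
exists (b + c * x), (e + c * y); split.
  have a_eq : a = 1 - b - c - e by lra.
  have bx : 0 <= b * x by rewrite mulr_ge0// ltW.
  have ey : 0 <= e * y by rewrite mulr_ge0// ltW.
  have cx : 0 <= c * x by rewrite mulr_ge0// ltW.
  have cy : 0 <= c * y by rewrite mulr_ge0// ltW.
  by split; [lra|lra| |]; nra.
have {}eW : W = O + (x *: (U - O) + y *: (V - O)) by rewrite -eW addrC subrK.
rewrite eW; have -> : a = 1 - b - c - e by lra.
by apply/rowP=> i; rewrite !mxE; ring.
Qed.

(** Both memberships together put (x', y') on the lines joining (1, 0) and (0, 1) to (x, y); these
    meet only in (x, y) because x + y > 1. *)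
Lemma in_quad_antisym (x y x' y' : R) :
  convex_coords x y -> convex_coords x' y' ->
  in_quad x y x' y' -> in_quad x' y' x y -> x = x' /\ y = y'.
Proof.
move=> [x0 y0 xy] [x'0 y'0 xy'] [_ _ h1 h2] [_ _ h3 h4].
have s : x + y = x' + y' by lra.
have e : (x + y - 1) * (y - y') = 0.
  have x'E : x' = x + y - y' by lra.
  by rewrite x'E in h1 h3; nra.
move/eqP: e; rewrite mulf_eq0 => /orP[] /eqP; lra.
Qed.

(* The affine map is (s, t) |-> (s + a t, b t) in the frames (O, U, V) and
   (O, U, V'). Since both quadrilaterals lie in the first quadrant and meet the
   second axis in [0, 1], surjectivity forces (a, b) = (0, 1); then the two
   coordinate quadrilaterals coincide. *)
Lemma affine_symmetric_vertices O U V W V' W' (f : pt -> pt) :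
  convex_frame O U V W -> convex_frame O U V' W' ->
  affine_map f -> f O = O -> f U = U ->
  f @` quadrilateral O U W V = quadrilateral O U W' V' ->
  f V = V' /\ f W = W'.
Proof.
move=> [_ [x [y [xy eW]]]] [fr' [x' [y' [xy' eW']]]] aff fO fU fQ.
have incl X : quadrilateral O U W V X -> quadrilateral O U W' V' (f X).
  by move=> QX; rewrite -fQ; exists X.
have [_ _ QW QV] := vertices_quadrilateral O U W V.
have [_ _ QW' QV'] := vertices_quadrilateral O U W' V'.
have [a [b [ab fV]]] := quadrilateral_coords xy' eW' (incl _ QV).
have fE (s t : R) : f (O + s *: (U - O) + t *: (V - O)) =
    O + (s + a * t) *: (U - O) + (b * t) *: (V' - O).
  by rewrite affine_map_coords// fO fU fV; apply/rowP=> i; rewrite !mxE; ring.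
have coordsE (s t s' t' : R) : O + s *: (U - O) + t *: (V' - O) =
    O + s' *: (U - O) + t' *: (V' - O) -> s = s' /\ t = t'.
  by rewrite -!addrA => /addrI /(free_pair_eq fr').
have pre X : quadrilateral O U W' V' X -> exists s t, in_quad x y s t /\
    X = O + (s + a * t) *: (U - O) + (b * t) *: (V' - O).
  rewrite -fQ => -[Y /(quadrilateral_coords xy eW)[s [t [st ->]]] <-].
  by exists s, t; rewrite fE.
have V'E : V' = O + 0 *: (U - O) + 1 *: (V' - O).
  by rewrite scale0r scale1r addr0 addrC subrK.
have WE : W = O + x *: (U - O) + y *: (V - O).
  by rewrite -addrA -eW addrC subrK.
have W'E : W' = O + x' *: (U - O) + y' *: (V' - O).
  by rewrite -addrA -eW' addrC subrK.
have [a0 b1] : a = 0 /\ b = 1.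
  (* A preimage (s, t) of [V'] satisfies s + a t = 0 and b t = 1. Signs force s = a = 0; then t and
     b are at most 1, hence both equal 1. *)
  have [s [t [[s0 t0 h1 h2] e]]] := pre _ QV'.
  move: e; rewrite {1}V'E => /coordsE[e1 e2].
  case: ab => a0 b0 k1 k2.
  have tN0 : t != 0 by apply/eqP=> te; move: e2; rewrite te mulr0; lra.
  have tp : 0 < t by rewrite lt0r tN0.
  have at0 : 0 <= a * t by rewrite mulr_ge0.
  have s00 : s = 0 by lra.
  have a00 : a = 0.
    have /eqP : a * t = 0 by lra.
    by rewrite mulf_eq0 (negPf tN0) orbF => /eqP.
  split=> //; rewrite s00 mulr0 in h2; rewrite a00 mulr0 in k2.
  case: xy xy' => x0 _ _ [x'0 _ _].
  have t1 : t <= 1 by rewrite -subr_le0 -(pmulr_lle0 _ x0).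
  have b1 : b <= 1 by rewrite -subr_le0 -(pmulr_lle0 _ x'0).
  nra.
have fV' : f V = V' by rewrite fV a0 b1 -V'E.
split=> //.
have fWE : f W = O + x *: (U - O) + y *: (V' - O).
  by rewrite {1}WE fE a0 b1 mul0r addr0 mul1r.
(* Now [f] keeps coordinates, so each of (x, y) and (x', y') lies in the coordinate quadrilateral of
   the other. *)
have [s [t [st]]] := pre _ QW'.
rewrite {1}W'E a0 b1 mul0r addr0 mul1r => /coordsE[es et].
have [s' [t' [st']]] := quadrilateral_coords xy' eW' (incl _ QW).
rewrite fWE => /coordsE[es' et'].
rewrite W'E; have [-> ->] // : x = x' /\ y = y'.
rewrite -es -et in st; rewrite -es' -et' in st'.
exact: in_quad_antisym.
Qed.

(** * Affine symmetry in terms of vertices *)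

Definition reflects (A0 A1 A2 B0 B1 B2 : pt) (f : pt -> pt) : Prop :=
  affine_map f /\ [/\ f A1 = A1, f B1 = B1, f A0 = A2 & f B0 = B2].

Lemma affine_symmetric_reflects A0 A1 A2 B0 B1 B2 :
  convex_frame A1 B1 A0 B0 -> convex_frame A1 B1 A2 B2 ->
  affine_symmetric (quadrilateral A0 B0 B1 A1) (quadrilateral A1 B1 B2 A2)
    (segment A1 B1) <->
  exists f, reflects A0 A1 A2 B0 B1 B2 f.
Proof.
(* Reversing the first face lets both vertex lists start with the common side [A1], [B1]. *)
move=> fr0 fr2; rewrite quadrilateral_rev; split=> [[f [aff fQ fix_]]|].
  have fA : f A1 = A1.
    by apply: fix_; exists 0; split; rewrite ?lexx ?ler01// scale0r addr0.
  have fB : f B1 = B1.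
    by apply: fix_; exists 1; split; rewrite ?lexx ?ler01// scale1r addrC subrK.
  have [] := affine_symmetric_vertices fr0 fr2 aff fA fB fQ.
  by exists f; split.
move=> [f [aff [fA1 fB1 fA0 fB0]]]; exists f; split=> //.
  by rewrite image_quadrilateral// fA1 fB1 fA0 fB0.
move=> X [t [_ _ e]]; apply: (affine_map_fix_line aff fA1 fB1).
by exists t.
Qed.

(** * Concurrent and parallel rulings *)

Lemma parallelP A B C D : parallel A B C D <->
  A != B /\ exists2 k : R, k != 0 & D - C = k *: (B - A).
Proof.
split.
  move=> [AB CD /eqmxP e]; split=> //.
  have /sub_rVP[k ek] : (D - C <= B - A)%MS by rewrite e.
  exists k => //; apply: contra_neq CD => k0.
  by apply/esym/subr0_eq; rewrite ek k0 scale0r.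
move=> [AB [k k0 e]]; split=> //.
  apply: contra_neq AB => CD; apply/esym/subr0_eq/eqP.
  by move/eqP: e; rewrite CD subrr eq_sym scaler_eq0 (negPf k0).
by apply/eqmxP; rewrite e; apply: eqmx_sym; exact: eqmx_scale.
Qed.

Lemma frame_neq O U V W : convex_frame O U V W -> O != U.
Proof.
move=> [fr _]; apply/eqP=> e; have [] := fr 1 0.
  by rewrite e subrr scaler0 scale0r addr0.
by move/eqP; rewrite oner_eq0.
Qed.

Lemma frame_notin_line O U V W : convex_frame O U V W -> ~ line O U V.
Proof.
move=> [fr _] [t e]; have [] := fr t (-1).
  by rewrite e addrAC subrr add0r scaleN1r subrr.
by move=> _ /eqP; rewrite oppr_eq0 oner_eq0.
Qed.

Lemma frame_concurrent_or_parallel A B C D : convex_frame A B C D ->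
  (exists2 O, line A B O & line C D O) \/ parallel A B C D.
Proof.
move=> fr; have AB := frame_neq fr; case: fr => _ [x [y [[x0 y0 _] e]]].
have [y1|y1] := eqVneq y 1.
  right; apply/parallelP; split=> //; exists x; first exact: lt0r_neq0.
  apply/rowP=> i; move/rowP: e => /(_ i); rewrite !mxE y1; lra.
left; have yN : 1 - y != 0 by rewrite subr_eq0 eq_sym.
(* The point of [C D] with parameter t has coordinates (t x, 1 + t (y - 1)); the second one vanishes
   at t = 1 / (1 - y). *)
exists (A + (x / (1 - y)) *: (B - A)); first by exists (x / (1 - y)).
exists (1 / (1 - y)); apply/rowP=> i; move/rowP: e => /(_ i); rewrite !mxE => e.
have -> : D 0 i = A 0 i + (x * (B 0 i - A 0 i) + y * (C 0 i - A 0 i)) by lra.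
by field.
Qed.

(** [B0] in the frame ([A1], [B1], [A0]) and [B2] in ([A1], [B1], [A2]) share their coordinates (x,
    y), so B2 - B0 = y (A2 - A0). *)
Lemma reflects_parallel A0 A1 A2 B0 B1 B2 f :
  convex_frame A1 B1 A0 B0 -> ~ collinear [:: A0; A2; B0; B2] ->
  reflects A0 A1 A2 B0 B1 B2 f -> parallel A0 A2 B0 B2.
Proof.
move=> [_ [x [y [[_ y0 _] e]]]] ncol [aff [fA1 fB1 fA0 fB0]].
have B0E : B0 = A1 + x *: (B1 - A1) + y *: (A0 - A1).
  by rewrite -addrA -e addrC subrK.
have B2E : B2 = A1 + x *: (B1 - A1) + y *: (A2 - A1).
  by rewrite -fB0 {1}B0E affine_map_coords// fA1 fB1 fA0.
apply/parallelP; split.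
  (* If [A0 = A2] then also [B0 = B2], and only two distinct points at most remain. *)
  apply/eqP=> A02; apply: ncol; exists A0, B0.
  have B02 : B0 = B2 by rewrite B0E B2E A02.
  move=> X; rewrite -A02 -B02 !inE orbA orbb orbb => /orP[] /eqP ->.
    exact: line_left.
  exact: line_right.
exists y; first exact: lt0r_neq0.
by apply/rowP=> i; rewrite B0E B2E !mxE; ring.
Qed.

(** If [O], [A0], [A2] were collinear, their line would contain [B0] and [B2]. Hence the vectors
    from [O] are independent, and comparing coefficients gives k = c = l. *)
Lemma homothety_ratio O A0 A2 B0 B2 (k l c : R) :
  ~ collinear [:: A0; A2; B0; B2] ->
  B0 - O = k *: (A0 - O) -> B2 - O = l *: (A2 - O) ->
  B2 - B0 = c *: (A2 - A0) -> k = l.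
Proof.
move=> ncol e0 e2 ec.
have B0E : B0 = O + k *: (A0 - O) by rewrite -e0 addrC subrK.
have B2E : B2 = O + l *: (A2 - O) by rewrite -e2 addrC subrK.
have e : (k - c) *: (A0 - O) + (c - l) *: (A2 - O) = 0.
  by apply/rowP=> i; move/rowP: ec => /(_ i); rewrite B0E B2E !mxE; lra.
suff fr : free_pair (A0 - O) (A2 - O) by have [] := fr _ _ e; lra.
apply: noncollinear_free => -[L [M h]]; apply: ncol; exists L, M.
have [o eo] : line L M O by apply: h; rewrite !inE eqxx ?orbT.
have [a ea] : line L M A0 by apply: h; rewrite !inE eqxx ?orbT.
have [b eb] : line L M A2 by apply: h; rewrite !inE eqxx ?orbT.
move=> X; rewrite !inE => /or4P[] /eqP ->; [by exists a|by exists b| |].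
- by exists (o + k * (a - o)); rewrite B0E eo ea; apply/rowP=> i; rewrite !mxE; ring.
- by exists (o + l * (b - o)); rewrite B2E eo eb; apply/rowP=> i; rewrite !mxE; ring.
Qed.

(** The case of [O] at infinity: (k - l) U = (1 - c) (A2 - A0), so k != l would put all four points
    on the line [A0 A2]. *)
Lemma translation_ratio U A0 A2 B0 B2 (k l c : R) :
  ~ collinear [:: A0; A2; B0; B2] ->
  B0 - A0 = k *: U -> B2 - A2 = l *: U ->
  B2 - B0 = c *: (A2 - A0) -> k = l.
Proof.
move=> ncol e0 e2 ec; apply/eqP; apply: contra_notT ncol => kl.
have kl0 : k - l != 0 by rewrite subr_eq0.
have UE : U = ((1 - c) / (k - l)) *: (A2 - A0).
  apply: (scalerI kl0); rewrite scalerA mulrC divfK//.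
  apply/rowP=> i; move/rowP: ec => /(_ i); move/rowP: e0 => /(_ i).
  by move/rowP: e2 => /(_ i); rewrite !mxE; lra.
exists A0, A2 => X; rewrite !inE => /or4P[] /eqP ->.
- exact: line_left.
- exact: line_right.
- by exists (k * ((1 - c) / (k - l))); rewrite -scalerA -UE -e0 addrC subrK.
- exists (1 + l * ((1 - c) / (k - l))).
  by rewrite scalerDl -scalerA -UE -e2 scale1r addrA (addrC A0) subrK addrC subrK.
Qed.

(** The map fixing [A1], [B1] and taking [A0] to [A2] also fixes [O]; since [O] divides both outer
    rulings in the same ratio, [B0] goes to [B2]. *)
Lemma concurrent_reflects O A0 A1 A2 B0 B1 B2 :
  convex_frame A1 B1 A0 B0 -> convex_frame A1 B1 A2 B2 ->
  ~ collinear [:: A0; A2; B0; B2] -> parallel A0 A2 B0 B2 ->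
  line A0 B0 O -> line A1 B1 O -> line A2 B2 O ->
  exists f, reflects A0 A1 A2 B0 B1 B2 f.
Proof.
move=> fr0 fr2 ncol /parallelP[_ [c _ ec]] [s Os] O1 [t Ot].
have [f [aff fA fB fA0]] := affine_map_of_frame A2 fr0.1.
exists f; split=> //; split=> //.
(* For s = 0 the point [O] of the line [A1 B1] would be [A0]. *)
have s0 : s != 0.
  apply: contra_notN (frame_notin_line fr0) => /eqP s0.
  by move: Os; rewrite s0 scale0r addr0 => <-.
have t0 : t != 0.
  apply: contra_notN (frame_notin_line fr2) => /eqP t0.
  by move: Ot; rewrite t0 scale0r addr0 => <-.
have eB0 : B0 - O = (1 - s^-1) *: (A0 - O).
  by rewrite Os; apply/rowP=> i; rewrite !mxE; field.
have eB2 : B2 - O = (1 - t^-1) *: (A2 - O).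
  by rewrite Ot; apply/rowP=> i; rewrite !mxE; field.
have st : s = t.
  by have := homothety_ratio ncol eB0 eB2 ec => /addrI /oppr_inj /invr_inj.
have := affine_map_fix_line aff fA fB O1.
rewrite {1}Os affine_map_line// fA0 Ot -st => /addrI /(scalerI s0).
by move/addIr.
Qed.

Lemma parallel_reflects A0 A1 A2 B0 B1 B2 :
  convex_frame A1 B1 A0 B0 ->
  ~ collinear [:: A0; A2; B0; B2] -> parallel A0 A2 B0 B2 ->
  parallel A1 B1 A0 B0 -> parallel A1 B1 A2 B2 ->
  exists f, reflects A0 A1 A2 B0 B1 B2 f.
Proof.
move=> fr0 ncol /parallelP[_ [c _ ec]] /parallelP[_ [k _ ek]].
move=> /parallelP[_ [l _ el]].
have [f [aff fA fB fA0]] := affine_map_of_frame A2 fr0.1.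
exists f; split=> //; split=> //.
have kl := translation_ratio ncol ek el ec.
have B0E : B0 = A1 + k *: (B1 - A1) + 1 *: (A0 - A1).
  by apply/rowP=> i; move/rowP: ek => /(_ i); rewrite !mxE; lra.
rewrite {1}B0E affine_map_coords// fA fB fA0.
by apply/rowP=> i; move/rowP: el => /(_ i); rewrite !mxE kl; lra.
Qed.

End PlaneGeometry.

(** * From pairs of faces to strips *)

Section Strips.
Context {R : realType} {d : nat}.
Implicit Types P Q : nat -> nat -> 'rV[R]_d.

Definition reflecting (n : nat) Q : Prop :=
  forall j, (j.+2 <= n)%N -> exists f,
    reflects (Q 0 j) (Q 0 j.+1) (Q 0 j.+2) (Q 1 j) (Q 1 j.+1) (Q 1 j.+2) f.

(** A face is described from each of its two rulings, so that two adjacent faces get frames on their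
    common ruling. *)
Lemma net_frames m n P i j : net m n P -> (i < m)%N -> (j < n)%N ->
  convex_frame (P i j) (P i.+1 j) (P i j.+1) (P i.+1 j.+1) /\
  convex_frame (P i j.+1) (P i.+1 j.+1) (P i j) (P i.+1 j).
Proof.
move=> hP im jn; have q := hP _ _ im jn; split.
  exact/convex_quad_frame/convex_quad_rev.
by apply: convex_quad_frame; do 3!apply: convex_quad_rot.
Qed.

(** Induction with two predecessors: [f] fixes [O] because [O] is on ruling j + 1, and it carries
    ruling j to ruling j + 2. *)
Lemma reflecting_concurrent n Q (O : 'rV[R]_d) : reflecting n Q ->
  line (Q 0 0) (Q 1 0) O -> line (Q 0 1) (Q 1 1) O ->
  forall j, (j <= n)%N -> line (Q 0 j) (Q 1 j) O.
Proof.
move=> refl O0 O1; elim/ltn_ind=> -[|[|j]] IH jn //.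
have [f [aff [fA fB fA0 fB0]]] := refl j jn.
have [t Ot] := IH j (ltnW (ltnSn _)) (ltnW (ltnW jn)).
exists t; rewrite -(affine_map_fix_line aff fA fB (IH _ (ltnSn _) (ltnW jn))).
by rewrite Ot affine_map_line// fA0 fB0.
Qed.

Lemma reflecting_parallel n Q : reflecting n Q ->
  parallel (Q 0 0) (Q 1 0) (Q 0 1) (Q 1 1) -> parallel_rulings n Q.
Proof.
move=> refl /parallelP[Q0 [r r0 er]].
have key j : (j <= n)%N ->
    exists2 k, k != 0 & Q 1 j - Q 0 j = k *: (Q 1 0 - Q 0 0).
  elim/ltn_ind: j => -[|[|j]] IH jn; [|by exists r|].
    by exists 1; rewrite ?oner_eq0// scale1r.
  have [f [[M [b fE]] [fA fB fA0 fB0]]] := refl j jn.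
  have [k k0 ek] := IH j (ltnW (ltnSn _)) (ltnW (ltnW jn)).
  have [l l0 el] := IH _ (ltnSn _) (ltnW jn).
  (* The linear part of [f] fixes the vector of ruling j + 1, hence the common direction; ruling j +
     2 then has the same vector as ruling j. *)
  have eM : (Q 1 0 - Q 0 0) *m M = Q 1 0 - Q 0 0.
    apply: (scalerI l0); rewrite scalemxAl -el.
    by rewrite -(affine_mapB _ _ fE) fA fB.
  by exists k => //; rewrite -fA0 -fB0 (affine_mapB _ _ fE) ek -scalemxAl eM.
move=> j k jn kn; have [a a0 ea] := key _ jn; have [b b0 eb] := key _ kn.
apply/parallelP; split.
  apply: contra_neq Q0 => e; apply/esym/subr0_eq/eqP.
  by move/eqP: ea; rewrite e subrr eq_sym scaler_eq0 (negPf a0).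
exists (b / a); first by rewrite mulf_neq0 ?invr_eq0.
by rewrite ea eb scalerA divfK.
Qed.

Lemma reflecting_doubled n Q : net 1 n Q ->
  (forall j, (j.+2 <= n)%N ->
    ~ collinear [:: Q 0 j; Q 0 j.+2; Q 1 j; Q 1 j.+2]) ->
  reflecting n Q <-> doubled_cone_cylinder_strip n Q.
Proof.
move=> hQ ncol; split=> [refl|[cone dbl] j jn].
  split=> [|j jn]; last first.
    split; last exact: ncol.
    have [f hf] := refl j jn; apply: reflects_parallel hf; last exact: ncol.
    by have [] := net_frames hQ (ltn0Sn 0) (ltnW jn).
  (* For n = 0 there is no face; any point of the single ruling serves as [O]. Otherwise the first
     face decides between cone and cylinder. *)
  case: n hQ refl {ncol} => [|n] hQ refl.
    left; exists (Q 0 0) => j; rewrite leqn0 => /eqP ->.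
    exact: line_left.
  have [fr _] := net_frames hQ (ltn0Sn 0) (ltn0Sn n).
  have [[O O0 O1]|par] := frame_concurrent_or_parallel fr.
    by left; exists O; exact: reflecting_concurrent O0 O1.
  by right; exact: reflecting_parallel par.
have [_ fr0] := net_frames hQ (ltn0Sn 0) (ltnW jn).
have [fr2 _] := net_frames hQ (ltn0Sn 0) jn.
have [par nc] := dbl j jn.
have j1n := ltnW jn; have j0n := ltnW j1n.
case: cone => [[O hO]|hpar].
  by apply: (@concurrent_reflects _ _ O) => //; exact: hO.
by apply: parallel_reflects => //; exact: hpar.
Qed.

Lemma strip_symmetric_doubled n Q : net 1 n Q ->
  each_sub_net 1 2 1 n Q (fun S => ~ collinear (corners 1 2 S)) ->
  each_sub_net 1 2 1 n Q affine_symmetric_1x2 <->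
  doubled_cone_cylinder_strip n Q.
Proof.
move=> hQ ncol; rewrite -reflecting_doubled //; last first.
  move=> j jn; have := ncol 0%N j isT; rewrite addn2 => /(_ jn).
  by rewrite /corners /sub_net !add0n addn0 addn2.
have symE j (jn : (j.+2 <= n)%N) : affine_symmetric_1x2 (sub_net 0 j Q) <->
    exists f,
    reflects (Q 0 j) (Q 0 j.+1) (Q 0 j.+2) (Q 1 j) (Q 1 j.+1) (Q 1 j.+2) f.
  rewrite /affine_symmetric_1x2 /face /sub_net !add0n addn0 addn1 addn2.
  apply: affine_symmetric_reflects.
    by have [] := net_frames hQ (ltn0Sn 0) (ltnW jn).
  by have [] := net_frames hQ (ltn0Sn 0) jn.
split=> h.
  by move=> j jn; apply/symE => //; apply: h => //; rewrite addn2.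
move=> p j; rewrite addn1 addn2 ltnS leqn0 => /eqP -> jn.
by apply/symE => //; exact: h.
Qed.

Lemma net_sub_net m n P p : net m n P -> (p < m)%N ->
  net 1 n (sub_net p 0 P).
Proof.
move=> hP pm i j; rewrite ltnS leqn0 => /eqP -> jn; rewrite /sub_net addn0 addn1 !add0n.
exact: hP.
Qed.

(** * From strips to nets, and the interchange of indices *)

Lemma symmetric_1x2_doubled m n P : net m n P ->
  each_sub_net 1 2 m n P (fun Q => ~ collinear (corners 1 2 Q)) ->
  each_sub_net 1 2 m n P affine_symmetric_1x2 <->
  each_sub_net 1 n m n P (doubled_cone_cylinder_strip n).
Proof.
move=> hP ncol.
have strip p (pm : (p + 1 <= m)%N) :
    each_sub_net 1 2 1 n (sub_net p 0 P) affine_symmetric_1x2 <->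
    doubled_cone_cylinder_strip n (sub_net p 0 P).
  apply: strip_symmetric_doubled.
    by apply: net_sub_net hP _; rewrite -addn1.
  by move=> r q; rewrite addn1 ltnS leqn0 => /eqP -> qn; exact: ncol.
split=> h p q pm qn.
  (* A sub-net of full width n can only start at index 0. *)
  have -> : q = 0%N by apply/eqP; rewrite -leqn0 -(leq_add2r n) add0n.
  apply/strip => // r s; rewrite addn1 ltnS leqn0 => /eqP -> sn; exact: h.
by apply: (proj2 (strip p pm) _ 0%N q) => //; apply: h; rewrite ?add0n.
Qed.

(** The interchange reverses the cyclic order of the vertices of each face. *)
Lemma net_net_tr m n P : net m n P -> net n m (net_tr P).
Proof. by move=> hP i j im jn; apply/convex_quad_rev/hP. Qed.

(** Faces are regions without labels, so the interchange leaves them equal as sets. *)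
Lemma affine_symmetric_2x1_tr P :
  affine_symmetric_2x1 P = affine_symmetric_1x2 (net_tr P).
Proof.
have faceE i j : face (net_tr P) i j = face P j i.
  by rewrite /face quadrilateral_rev -quadrilateral_rot.
by rewrite /affine_symmetric_1x2 !faceE.
Qed.

Lemma each_sub_net_tr a b m n P (K : (nat -> nat -> 'rV[R]_d) -> Prop) :
  each_sub_net a b m n P (fun Q => K (net_tr Q)) <->
  each_sub_net b a n m (net_tr P) K.
Proof. by split=> h p q hp hq; exact: h. Qed.

End Strips.

Theorem proposition3p3 (R : realType) (d m n : nat)
    (P : nat -> nat -> 'rV[R]_d)
    (hP : net m n P)
    (h21 : each_sub_net 2 1 m n P (fun Q => ~ collinear (corners 2 1 Q)))
    (h12 : each_sub_net 1 2 m n P (fun Q => ~ collinear (corners 1 2 Q))) :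
  (each_sub_net 1 2 m n P affine_symmetric_1x2 \/
   each_sub_net 2 1 m n P affine_symmetric_2x1)
  <-> doubled_cone_cylinder_net m n P.
Proof.
have E12 := symmetric_1x2_doubled hP h12.
(* The disjuncts correspond one to one; the second equivalence is the first one for [net_tr P]. *)
suff E21 : each_sub_net 2 1 m n P affine_symmetric_2x1 <->
    each_sub_net m 1 m n P (fun Q => doubled_cone_cylinder_strip m (net_tr Q)).
  by rewrite /doubled_cone_cylinder_net E12 E21.
have -> : affine_symmetric_2x1 =
    (fun Q : nat -> nat -> 'rV[R]_d => affine_symmetric_1x2 (net_tr Q)).
  by apply/funext=> Q; exact: affine_symmetric_2x1_tr.
rewrite !each_sub_net_tr; apply: symmetric_1x2_doubled.
  exact: net_net_tr.
apply/each_sub_net_tr => p q pm qn col; apply: (h21 p q pm qn).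
(* The interchange only permutes the four corners. *)
apply: collinear_sub col => X; rewrite !inE => /or4P[] ->; rewrite ?orbT //.
Qed.
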